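(* Let $\alpha\in[0,1]$. For every $w=(w_1,w_2,w_3)\in\mathbb{R}^3$, $$\|w\|_\alpha^2\ \ge\ w_1^2+\alpha w_2^2+\alpha w_3^2 .$$
   Context: For $\alpha\in[0,1]$ and $w=(w_1,w_2,w_3)\in\mathbb{R}^3$, $\|w\|_\alpha=\sqrt{w_1^2+w_2^2+w_3^2-2(1-\alpha)w_2w_3}$. *)

(* Defs.v *)
From mathcomp Require Import all_boot all_order all_algebra.
From mathcomp Require Import reals.

Set Implicit Arguments.
Unset Strict Implicit.
Unset Printing Implicit Defensive.

Import Order.TTheory GRing.Theory Num.Theory.
Local Open Scope ring_scope.

(* Coordinates are 0-based: w_1, w_2, w_3 are [w 0 0], [w 0 1], [w 0 2].
   [Num.sqrt] is 0 on negative arguments; for 0 <= alpha <= 1 the radicand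
   is nonnegative, so this convention plays no role there. *)
Definition norm_alpha (R : realType) (alpha : R) (w : 'rV[R]_3) : R :=
  Num.sqrt (w 0 0 ^+ 2 + w 0 1 ^+ 2 + w 0 2 ^+ 2
            - 2 * (1 - alpha) * w 0 1 * w 0 2).

(* Main.v *)
Require Import Defs.
From mathcomp Require Import all_boot all_order all_algebra.
From mathcomp Require Import reals.
From mathcomp Require Import ring.

Import Order.TTheory GRing.Theory Num.Theory.
Local Open Scope ring_scope.

Theorem mainTheorem2 (R : realType) (alpha : R)
    (halpha : 0 <= alpha <= 1) (w : 'rV[R]_3) :
  norm_alpha alpha w ^+ 2 >=
    w 0 0 ^+ 2 + alpha * w 0 1 ^+ 2 + alpha * w 0 2 ^+ 2.
Proof.
case/andP: halpha => alpha_ge0 alpha_le1.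
rewrite /norm_alpha.
(* Writing the coefficient 1 of the last two squares as alpha + (1 - alpha)
   completes the square: the radicand exceeds the lower bound by exactly
   (1 - alpha) (w_2 - w_3)^2. As the lower bound is itself nonnegative, so is
   the radicand, and squaring cancels the root. *)
have -> : w 0 0 ^+ 2 + w 0 1 ^+ 2 + w 0 2 ^+ 2
            - 2 * (1 - alpha) * w 0 1 * w 0 2
        = w 0 0 ^+ 2 + alpha * w 0 1 ^+ 2 + alpha * w 0 2 ^+ 2
            + (1 - alpha) * (w 0 1 - w 0 2) ^+ 2 by ring.
have gap_ge0 : 0 <= (1 - alpha) * (w 0 1 - w 0 2) ^+ 2.
  by apply: mulr_ge0; rewrite ?subr_ge0 ?sqr_ge0.
have bound_ge0 : 0 <= w 0 0 ^+ 2 + alpha * w 0 1 ^+ 2 + alpha * w 0 2 ^+ 2.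
  by rewrite !addr_ge0 ?sqr_ge0 //; apply: mulr_ge0; rewrite ?sqr_ge0.
by rewrite sqr_sqrtr ?lerDl // addr_ge0.
Qed.
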